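(* Let $M$ be a total dtla. If $M$ is equivalent to a dtop (i.e., $[\![M]\!]=[\![N]\!]$ for some dtop $N$), then $\mathrm{diff}(M)$ is finite.
   Context: Trees and patterns. $T_\Delta(Z)$ is the set of trees over ranked alphabet $\Delta$ with extra nullary symbols $Z$; $t/v$ is the subtree at node $v\in\mathbb N_+^*$; $\bot$ is a special nullary symbol; $V_\bot(t)$ is the set of nodes labelled $\bot$. $\sqcap\{t,t'\}$ denotes the largest common prefix of $t$ and $t'$ (greatest lower bound w.r.t. the order in which $\bot$ may be replaced by trees), having $\bot$ at the highest nodes where $t,t'$ disagree. A $\Sigma$-context is $C\in T_\Sigma(\{\bot\})$ with exactly one occurrence of $\bot$; $\mathcal C_\Sigma$ is their set. Dtlas. A dtla $M$ from $\Sigma$ to $\Delta$ consists of a finite set $Q$ of states, a total deterministic bottom-up tree automaton with finite state set $P$ and transitions $\delta(a,p_1,\dots,p_k)$, extended to $\delta_M:T_\Sigma\to P$, an axiom $A_M(p)\in T_\Delta(Q(\{x_0\}))$ for each $p\in P$, and at most one rule $q(a(x_1\langle p_1\rangle,\dots,x_k\langle p_k\rangle))\to\mathrm{rhs}_M(q,a,p_1,\dots,p_k)\in T_\Delta(Q(X_k))$ per $q,a,p_1,\dots,p_k$. Semantics: $q_M(a(s_1,\dots,s_k))=\mathrm{rhs}_M(q,a,\delta_M(s_1),\dots,\delta_M(s_k))[q'(x_i)\leftarrow q'_M(s_i)]$, $M(s)=A_M(\delta_M(s))[q(x_0)\leftarrow q_M(s)]$, defining the translation $[\![M]\!]$; $M$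 is total if $[\![M]\!]$ is total. A dtop is a dtla with one look-ahead state. For $C\in\mathcal C_\Sigma$, $p\in P$, $M(C[p])\in T_\Delta(Q\times P)$ is the output on $C$ with the hole treated as a leaf with look-ahead state $p$ and $q_M(p)=\langle q,p\rangle$. Difference trees: $\mathrm{diff}(M)=\{M(C[p])/v\mid C\in\mathcal C_\Sigma,\ p,p'\in P,\ v\in V_\bot(M(C[p])\sqcap M(C[p']))\}$. *)

(* Defs.v *)
From mathcomp Require Import all_boot.
From Stdlib Require List.
Set Implicit Arguments. Unset Strict Implicit. Unset Printing Implicit Defensive.

(* separate predicate.  Children are indexed from 0 in node addresses. *)
Inductive tree (L : Type) : Type := Node of L & seq (tree L).
Arguments Node {L} _ _.

Fixpoint tmap (L L' : Type) (f : L -> L') (t : tree L) : tree L' :=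
  let: Node l ts := t in Node (f l) (map (tmap f) ts).

Fixpoint wfT (L : Type) (rk : L -> nat) (t : tree L) : bool :=
  let: Node l ts := t in (size ts == rk l) && all (wfT rk) ts.

Fixpoint labels (L : Type) (t : tree L) : seq L :=
  let: Node l ts := t in l :: flatten (map (@labels L) ts).

Definition sumrank (L Z : Type) (rk : L -> nat) (x : L + Z) : nat :=
  match x with inl l => rk l | inr _ => 0 end.

(* subtree t/v at node v (a path of 0-based child indices) *)
Fixpoint subtree (L : Type) (t : tree L) (v : seq nat) : option (tree L) :=
  match v with
  | [::] => Some t
  | i :: v' => let: Node _ ts := t in
               match drop i ts with
               | t' :: _ => subtree t' v'
               | [::] => None
               end
  end.

(* greatest lower bound  t ⊓ t' ; the label None plays the role of ⊥ *)
Fixpoint meet (L : eqType) (t1 t2 : tree L) {struct t1} : tree (option L) :=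
  let: Node l1 ts1 := t1 in
  let: Node l2 ts2 := t2 in
  if (l1 == l2) && (size ts1 == size ts2) then
    Node (Some l1)
      ((fix go (a b : seq (tree L)) : seq (tree (option L)) :=
          match a, b with
          | x :: a', y :: b' => meet x y :: go a' b'
          | _, _ => [::]
          end) ts1 ts2)
  else Node None [::].

Definition is_bot_node (L : Type) (t : tree (option L)) (v : seq nat) : bool :=
  if subtree t v is Some (Node None _) then true else false.

Fixpoint osequence (A : Type) (s : seq (option A)) : option (seq A) :=
  match s with
  | [::] => Some [::]
  | o :: s' => match o, osequence s' with
               | Some a, Some r => Some (a :: r)
               | _, _ => None
               end
  end.

Fixpoint tsubst (D A B : Type) (f : A -> option (tree (D + B)))
    (t : tree (D + A)) : option (tree (D + B)) :=
  let: Node l ts := t in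
  match l with
  | inl d => match osequence (map (tsubst f) ts) with
             | Some ts' => Some (Node (inl d) ts')
             | None => None
             end
  | inr a => f a
  end.

(* Deterministic top-down tree transducers with regular look-ahead.   *)
(* - axiom A_M(p) ∈ T_Δ(Q({x0})): tree over Δ + Q (leaf inr q = q(x0)) *)
(* - rhs_M(q,a,p1..pk) ∈ T_Δ(Q(X_k)): tree over Δ + Q*nat, where the  *)
(*   leaf inr (q,i) stands for q(x_i), 1 <= i <= k = rank a;           *)
(*   None means there is no rule.                                     *)
(* - delta: transitions of the total deterministic bottom-up look-ahead *)
(*   automaton (only used on argument lists of length rank a).         *)
Record dtla (Sigma Delta : finType) (rkS : Sigma -> nat) (rkD : Delta -> nat) :=
  Dtla {
    stQ : finType;
    stP : finType;
    delta : Sigma -> seq stP -> stP;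
    axm : stP -> tree (Delta + stQ);
    rhs : stQ -> Sigma -> seq stP -> option (tree (Delta + (stQ * nat)));
    axm_wf : forall p, wfT (sumrank rkD) (axm p);
    rhs_wf : forall q a ps r, size ps = rkS a -> rhs q a ps = Some r ->
      wfT (sumrank rkD) r &&
      all (fun x => if x is inr (_, i) then (0 < i <= rkS a) else true) (labels r)
  }.

Section Semantics.
Variables (Sigma Delta : finType) (rkS : Sigma -> nat) (rkD : Delta -> nat).
Variable M : dtla rkS rkD.

(* Input trees over Σ + X: a leaf inr x has look-ahead state (look x)  *)
(* and, for each state q, output (hq q x).                              *)
Variables (X Z : Type) (look : X -> stP M) (hq : stQ M -> X -> tree (Delta + Z)).

Fixpoint lstate (t : tree (Sigma + X)) : stP M :=
  let: Node l ts := t in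
  match l with
  | inl a => @delta _ _ _ _ M a (map lstate ts)
  | inr x => look x
  end.

Fixpoint qrun (q : stQ M) (t : tree (Sigma + X)) {struct t}
    : option (tree (Delta + Z)) :=
  let: Node l ts := t in
  match l with
  | inr x => Some (hq q x)
  | inl a =>
      let res := map (fun t' q' => qrun q' t') ts in
      match @rhs _ _ _ _ M q a (map lstate ts) with
      | None => None
      | Some r =>
          tsubst (fun qi : stQ M * nat =>
                    nth (fun _ => None) res qi.2.-1 qi.1) r
      end
  end.

Definition run (t : tree (Sigma + X)) : option (tree (Delta + Z)) :=
  tsubst (fun q => qrun q t) (@axm _ _ _ _ M (lstate t)).

End Semantics.

Section Translation.
Variables (Sigma Delta : finType) (rkS : Sigma -> nat) (rkD : Delta -> nat).

(* ground input trees T_Σ are trees over Σ (well-ranked w.r.t. rkS);  *)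
(* ground output trees T_Δ are represented as trees over Δ + void.    *)
Definition ground_in (s : tree Sigma) : tree (Sigma + void) := tmap inl s.

Definition gstate (M : dtla rkS rkD) (s : tree Sigma) : stP M :=
  lstate (M := M) (X := void) (of_void _) (ground_in s).

Definition transl (M : dtla rkS rkD) (s : tree Sigma) : option (tree (Delta + void)) :=
  run (M := M) (X := void) (Z := void) (of_void _) (fun _ => of_void _) (ground_in s).

Definition total_dtla (M : dtla rkS rkD) : Prop :=
  forall s, wfT rkS s -> transl M s <> None.

Definition equivalent (M N : dtla rkS rkD) : Prop :=
  forall s, wfT rkS s -> transl M s = transl N s.

Definition is_dtop (N : dtla rkS rkD) : Prop := #|stP N| = 1.

Definition la_reachable (M : dtla rkS rkD) : Prop :=
  forall p : stP M, exists s, wfT rkS s /\ gstate M s = p.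

(* Σ-contexts: trees over Σ + {⊥} (⊥ = inr tt) with exactly one ⊥ *)
Definition is_context (C : tree (Sigma + unit)) : bool :=
  wfT (sumrank rkS) C && (count (fun x => if x is inr _ then true else false)
                                (labels C) == 1).

(* M(C[p]) ∈ T_Δ(Q × P) *)
Definition ctx_out (M : dtla rkS rkD) (C : tree (Sigma + unit)) (p : stP M)
    : option (tree (Delta + (stQ M * stP M))) :=
  run (M := M) (X := unit) (Z := stQ M * stP M) (fun _ => p)
      (fun q _ => Node (inr (q, p)) [::]) C.

Definition diff (M : dtla rkS rkD) (t : tree (Delta + (stQ M * stP M))) : Prop :=
  exists C p p' t1 t2 v,
    [/\ is_context C, ctx_out C p = Some t1, ctx_out C p' = Some t2,
        is_bot_node (meet t1 t2) v & subtree t1 v = Some t].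

Definition finite_set (A : Type) (S : A -> Prop) : Prop :=
  exists l : seq A, forall a, S a -> List.In a l.

End Translation.

(* Main.v *)
Require Import Defs.
From mathcomp Require Import all_boot.
From Stdlib Require List.
Set Implicit Arguments. Unset Strict Implicit. Unset Printing Implicit Defensive.

(* Fix for every look-ahead state p of M a ground tree [wit p] with δ_M(wit p) = p,
   and let N be a dtop equivalent to M.  For a context C, M(C[wit p]) is M(C[p])
   with every leaf ⟨q,p⟩ replaced by q_M(wit p); it also equals N(C[wit p]),
   which is a skeleton N(C[⊥]) independent of p with leaves replaced by outputs
   of N on [wit p].  At a node where M(C[p]) and M(C[p']) disagree, the skeleton
   either has already stopped, or continues and then must stop at a leaf of
   M(C[p']); in both cases the height of the subtree of M(C[p]) there is bounded
   by the largest height of an output q_M(wit p) plus that of an r_N(wit p).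
   Well-ranked trees of bounded height over finite alphabets are finitely many. *)

Lemma tree_ind_in (L : Type) (P : tree L -> Prop) :
  (forall l ts, (forall t, List.In t ts -> P t) -> P (Node l ts)) -> forall t, P t.
Proof.
move=> IH; fix F 1 => -[l ts]; apply: IH.
elim: ts => [|t ts IHts] u /=; first by case.
have Ft := F t; case=> [<- | Hu]; [exact: Ft | exact: IHts Hu].
Qed.

Lemma map_ext_in (T U : Type) (f g : T -> U) (s : seq T) :
  (forall x, List.In x s -> f x = g x) -> map f s = map g s.
Proof. by elim: s => //= x s IH E; rewrite E ?IH // => [y Hy|]; [apply: E; right | left]. Qed.

Lemma all_In (T : Type) (p : pred T) (s : seq T) :
  all p s <-> (forall x, List.In x s -> p x).
Proof.
elim: s => [|y s IH] //=; split.
- by move/andP=> [py /IH H] x [<-|/H].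
- by move=> H; rewrite H /=; [apply/IH => x Hx; apply: H; right | left].
Qed.

Lemma drop_In (T : Type) (s : seq T) i x r : drop i s = x :: r -> List.In x s.
Proof. by elim: s i => [|y s IH] [|i] //= => [[->]|/IH]; [left | right]. Qed.

Lemma osequence_Forall2 (T U : Type) (h : T -> option U) ts us :
  osequence (map h ts) = Some us -> List.Forall2 (fun t u => h t = Some u) ts us.
Proof.
elim: ts us => [|t ts IH] us /=; first by case=> <-.
case Ht: (h t) => [a|] //; case E: (osequence _) => [r|] // [<-].
by constructor; [|apply: IH].
Qed.

Lemma osequence_map_obind (T U V : Type) (h : T -> option U) (g : U -> option V) ts :
  obind (fun us => osequence (map g us)) (osequence (map h ts)) =
  osequence (map (fun t => obind g (h t)) ts).
Proof.
elim: ts => [|t ts IH] //=; case: (h t) => [a|] //=; move: IH.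
by case: (osequence (map h ts)) => [r|] /= <- //; case: (g a).
Qed.

Lemma Forall2_size (T U : Type) (R : T -> U -> Prop) xs ys :
  List.Forall2 R xs ys -> size xs = size ys.
Proof. by elim=> //= a b xs' ys' _ _ ->. Qed.

Lemma Forall2_In_l (T U : Type) (R : T -> U -> Prop) xs ys y :
  List.Forall2 R xs ys -> List.In y ys -> exists2 x, List.In x xs & R x y.
Proof.
elim=> //= a b xs' ys' Rab _ IH [<-|/IH [x Hx Rx]]; first by exists a; [left|].
by exists x; [right|].
Qed.

Lemma Forall2_drop_l (T U : Type) (R : T -> U -> Prop) xs ys i y r :
  List.Forall2 R xs ys -> drop i ys = y :: r -> exists x r', drop i xs = x :: r' /\ R x y.
Proof.
move=> F; elim: F i => [|a b xs' ys' Rab _ IH] [|i] //=; last exact: IH.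
by case=> <- _; exists a, xs'.
Qed.

Lemma Forall2_drop_r (T U : Type) (R : T -> U -> Prop) xs ys i x r :
  List.Forall2 R xs ys -> drop i xs = x :: r -> exists y r', drop i ys = y :: r' /\ R x y.
Proof.
move=> F; elim: F i => [|a b xs' ys' Rab _ IH] [|i] //=; last exact: IH.
by case=> <- _; exists b, ys'.
Qed.

Section Substitution.
Variables (D : Type) (rk : D -> nat).

Fixpoint height (A : Type) (t : tree (D + A)) : nat :=
  let: Node l ts := t in
  if l is inl _ then (foldr maxn 0 (map (@height A) ts)).+1 else 0.

Lemma height_In (A : Type) (t : tree (D + A)) ts :
  List.In t ts -> height t <= foldr maxn 0 (map (@height A) ts).
Proof.
elim: ts => [|u ts IH] //= [->|/IH H]; first exact: leq_maxl.
exact: leq_trans H (leq_maxr _ _).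
Qed.

Lemma foldr_maxn_Forall2 (T U : Type) (f : T -> nat) (g : U -> nat) k xs ys :
  List.Forall2 (fun x y => f x <= g y + k) xs ys ->
  foldr maxn 0 (map f xs) <= foldr maxn 0 (map g ys) + k.
Proof.
elim=> //= a b xs' ys' Hab _ IH; rewrite geq_max.
by rewrite (leq_trans Hab) ?(leq_trans IH) // leq_add2r (leq_maxl, leq_maxr).
Qed.

Lemma tsubst_ext (A B : Type) (f f' : A -> option (tree (D + B))) t :
  f =1 f' -> tsubst f t = tsubst f' t.
Proof.
move=> E; elim/tree_ind_in: t => [[d|a] ts IH] /=; last exact: E.
by rewrite (map_ext_in IH).
Qed.

Lemma tsubst_obind (A B C : Type) (h : A -> option (tree (D + B)))
    (g : B -> option (tree (D + C))) t :
  obind (tsubst g) (tsubst h t) = tsubst (fun a => obind (tsubst g) (h a)) t.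
Proof.
elim/tree_ind_in: t => [[d|a] ts IH] //=.
rewrite -(map_ext_in IH) -osequence_map_obind.
by case: (osequence (map (tsubst h) ts)).
Qed.

Lemma tsubst_inl (A B : Type) (f : A -> option (tree (D + B))) d ts u :
  tsubst f (Node (inl d) ts) = Some u -> exists2 us, u = Node (inl d) us & size us = size ts.
Proof.
rewrite /=; case E: (osequence _) => [us|] // [<-]; exists us => //.
by rewrite (Forall2_size (osequence_Forall2 E)).
Qed.

Lemma tsubst_wf (A B : Type) (f : A -> option (tree (D + B))) t u :
  (forall a v, f a = Some v -> wfT (sumrank rk) v) ->
  wfT (sumrank rk) t -> tsubst f t = Some u -> wfT (sumrank rk) u.
Proof.
move=> Hf; elim/tree_ind_in: t u => [[d|a] ts IH] u /=; last by move=> _ /Hf.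
move=> /andP[/eqP Hs /all_In Hall].
case E: (osequence _) => [us|] // [<-] /=; have F := osequence_Forall2 E.
rewrite -(Forall2_size F) Hs eqxx; apply/all_In => v /(Forall2_In_l F) [t Ht Htv].
exact: IH _ Ht _ (Hall _ Ht) Htv.
Qed.

Lemma height_tsubst_ge (A B : Type) (f : A -> option (tree (D + B))) t u :
  tsubst f t = Some u -> height t <= height u.
Proof.
elim/tree_ind_in: t u => [[d|a] ts IH] u //=.
case E: (osequence _) => [us|] // [<-] /=.
rewrite ltnS -[X in _ <= X]addn0; apply: foldr_maxn_Forall2.
elim: (osequence_Forall2 E) IH => [|x y xs ys Hxy _ IHF] Hl; constructor.
- by rewrite addn0; apply: Hl Hxy; left.
- by apply: IHF => t Ht; apply: Hl; right.
Qed.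

Lemma height_tsubst_le (A B : Type) (f : A -> option (tree (D + B))) k t u :
  (forall a v, f a = Some v -> height v <= k) ->
  tsubst f t = Some u -> height u <= height t + k.
Proof.
move=> Hf; elim/tree_ind_in: t u => [[d|a] ts IH] u /=; last by move/Hf.
case E: (osequence _) => [us|] // [<-] /=.
rewrite addSn ltnS; apply: foldr_maxn_Forall2.
elim: (osequence_Forall2 E) IH => [|x y xs ys Hxy _ IHF] Hl; constructor.
- by apply: Hl Hxy; left.
- by apply: IHF => t Ht; apply: Hl; right.
Qed.

Lemma subtree_wf (A : Type) (t : tree (D + A)) v u :
  wfT (sumrank rk) t -> subtree t v = Some u -> wfT (sumrank rk) u /\ height u <= height t.
Proof.
elim: v t => [|i v IH] [l ts] /=; first by move=> ? [<-].
move=> /andP[/eqP Hs /all_In Hall].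
case E: (drop i ts) => [|x r] // /(IH _ (Hall _ (drop_In E))) [Hu Hh].
split=> //; case: l Hs => [d|a] /= Hs; last by move: E; rewrite (size0nil Hs); case: i.
exact: leq_trans Hh (leq_trans (height_In (drop_In E)) (leqnSn _)).
Qed.

Lemma subtree_tsubst (A B : Type) (f : A -> option (tree (D + B))) t v x u :
  wfT (sumrank rk) t -> subtree t v = Some x -> tsubst f t = Some u ->
  exists2 y, subtree u v = Some y & tsubst f x = Some y.
Proof.
elim: v t u => [|i v IH] [l ts] u /=; first by move=> _ [<-] H; exists u.
move=> /andP[/eqP Hs /all_In Hall].
case E: (drop i ts) => [|x' r] // Hsub.
case: l Hs => [d|a] /= Hs; last by move: E; rewrite (size0nil Hs); case: i.
case E2: (osequence _) => [us|] // [<-] /=.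
have [y [r' [-> Hxy]]] := Forall2_drop_r (osequence_Forall2 E2) E.
exact: IH _ _ (Hall _ (drop_In E)) Hsub Hxy.
Qed.

Lemma subtree_tsubst_cases (A B : Type) (f : A -> option (tree (D + B))) k t v u y :
  (forall a w, f a = Some w -> wfT (sumrank rk) w /\ height w <= k) ->
  tsubst f t = Some u -> subtree u v = Some y ->
  height y <= k \/
  exists d ts, subtree t v = Some (Node (inl d) ts) /\ tsubst f (Node (inl d) ts) = Some y.
Proof.
move=> Hf; elim: v t u => [|i v IH] [[d|a] ts] u /=.
- by move=> Hu [<-]; right; exists d, ts.
- move=> /Hf [_ Hk] [<-]; by left.
- case E2: (osequence _) => [us|] // [<-] /=.
  case E: (drop i us) => [|x r] // Hsub.
  have [x' [r' [-> Hxy]]] := Forall2_drop_l (osequence_Forall2 E2) E.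
  exact: IH _ _ Hxy Hsub.
- move=> /Hf [Hw Hk] Hsub; left.
  by have [_ Hh] := subtree_wf (v := i :: v) Hw Hsub; apply: leq_trans Hh Hk.
Qed.

End Substitution.

Section Meet.
Variable L : eqType.

Fixpoint meet_seq (a b : seq (tree L)) : seq (tree (option L)) :=
  match a, b with
  | x :: a', y :: b' => meet x y :: meet_seq a' b'
  | _, _ => [::]
  end.

Lemma meetE (l1 l2 : L) ts1 ts2 : meet (Node l1 ts1) (Node l2 ts2) =
  if (l1 == l2) && (size ts1 == size ts2) then Node (Some l1) (meet_seq ts1 ts2)
  else Node None [::].
Proof. by []. Qed.

Lemma drop_meet_seq a b i t r : drop i (meet_seq a b) = t :: r ->
  exists x y ra rb, [/\ drop i a = x :: ra, drop i b = y :: rb & t = meet x y].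
Proof.
elim: a b i => [|x a IH] [|y b] [|i] //=; last exact: IH.
by case=> <- _; exists x, y, a, b.
Qed.

Lemma meet_bot (t1 t2 : tree L) v : is_bot_node (meet t1 t2) v ->
  exists l1 ts1 l2 ts2, [/\ subtree t1 v = Some (Node l1 ts1),
    subtree t2 v = Some (Node l2 ts2) & ~~ ((l1 == l2) && (size ts1 == size ts2))].
Proof.
rewrite /is_bot_node.
elim: v t1 t2 => [|i v IH] [l1 ts1] [l2 ts2]; rewrite meetE.
- by case: ifP => H //= _; exists l1, ts1, l2, ts2; rewrite H.
- case: ifP => H /=; last by case: i.
  case E: (drop i (meet_seq ts1 ts2)) => [|t r] //.
  have [x [y [ra [rb [-> -> ->]]]]] := drop_meet_seq E; exact: IH.
Qed.

End Meet.

(* If the disagreement node [v] lies in the skeleton [y], then [t2/v] must be a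
   leaf of [t2], so [y/v], and with it [t1/v], is bounded via [k1]; otherwise
   [v] lies inside a tree substituted into [y], of height at most [k2]. *)
Lemma bot_node_height (D A : eqType) (B Z : Type) (rk : D -> nat)
    (t1 t2 : tree (D + A)) (y : tree (D + B)) (g1 g2 : A -> option (tree (D + Z)))
    (h1 h2 : B -> option (tree (D + Z))) k1 k2 v x u1 u2 :
  wfT (sumrank rk) t1 -> wfT (sumrank rk) t2 -> wfT (sumrank rk) y ->
  (forall a w, g2 a = Some w -> height w <= k1) ->
  (forall b w, h1 b = Some w -> wfT (sumrank rk) w /\ height w <= k2) ->
  tsubst g1 t1 = Some u1 -> tsubst h1 y = Some u1 ->
  tsubst g2 t2 = Some u2 -> tsubst h2 y = Some u2 ->
  is_bot_node (meet t1 t2) v -> subtree t1 v = Some x -> height x <= k1 + k2.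
Proof.
move=> wf1 wf2 wfy Hg2 Hh1 E1 F1 E2 F2 /meet_bot [l1 [ts1 [l2 [ts2 [S1 S2 Hne]]]]].
rewrite S1 => -[<-] {x}; case: l1 S1 Hne => [e1|//] S1 Hne.
have [x1 X1 T1] := subtree_tsubst wf1 S1 E1.
apply: leq_trans (height_tsubst_ge T1) _.
have [Hx1 | [d [ys [Yv Y1]]]] := subtree_tsubst_cases Hh1 F1 X1.
  exact: leq_trans Hx1 (leq_addl _ _).
have [x2 X2 T2] := subtree_tsubst wf2 S2 E2.
have [x2' X2' Y2] := subtree_tsubst wfy Yv F2.
move: Y2; rewrite X2' in X2; case: X2 => -> Y2.
case: l2 S2 Hne T2 => [e2|a2] S2 Hne T2.
  have [xs1 Ex1 Sx1] := tsubst_inl T1; have [ys1 Ey1 Sy1] := tsubst_inl Y1.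
  have [xs2 Ex2 Sx2] := tsubst_inl T2; have [ys2 Ey2 Sy2] := tsubst_inl Y2.
  move: Ey1 Ey2; rewrite Ex1 Ex2 => -[De1 Exy1] [De2 Exy2].
  by rewrite De1 De2 -Sx1 -Sx2 Exy1 Exy2 Sy1 Sy2 !eqxx in Hne.
have Hk1 : height x2 <= k1 by apply: Hg2 T2.
have Hy := leq_trans (height_tsubst_ge Y2) Hk1.
have Hx1 := height_tsubst_le (fun b w Hb => proj2 (Hh1 b w Hb)) Y1.
by apply: leq_trans Hx1 _; rewrite leq_add2r.
Qed.

Section BoundedTrees.
Variables (D Z : finType) (rk : D -> nat).

Fixpoint tuples (T : Type) (k : nat) (l : seq T) : seq (seq T) :=
  if k is k'.+1 then List.flat_map (fun x => List.map (cons x) (tuples k' l)) l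
  else [:: [::]].

Lemma tuples_complete (T : Type) (l : seq T) ts :
  (forall x, List.In x ts -> List.In x l) -> List.In ts (tuples (size ts) l).
Proof.
elim: ts => [|x ts IH] H /=; first by left.
apply/List.in_flat_map; exists x; split; first by apply: H; left.
by apply: List.in_map; apply: IH => y Hy; apply: H; right.
Qed.

Lemma In_enum (T : finType) (x : T) : List.In x (enum T).
Proof.
have : x \in enum T by rewrite mem_enum.
by elim: (enum T) => [|y s IH] //; rewrite in_cons => /orP[/eqP ->|/IH]; [left | right].
Qed.

Fixpoint trees_upto (n : nat) : seq (tree (D + Z)) :=
  List.map (fun z => Node (inr z) [::]) (enum Z) ++
  if n is n'.+1 then
    List.flat_map (fun d => List.map (Node (inl d)) (tuples (rk d) (trees_upto n'))) (enum D)
  else [::].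

Lemma trees_upto_complete (t : tree (D + Z)) n :
  wfT (sumrank rk) t -> height t <= n -> List.In t (trees_upto n).
Proof.
elim/tree_ind_in: t n => [[d|z] ts IH] n /= /andP[/eqP Hs /all_In Hall] Hh.
- case: n Hh => [//|n] Hh /=; apply: List.in_or_app; right.
  apply/List.in_flat_map; exists d; split; first exact: In_enum.
  apply: List.in_map; rewrite -Hs; apply: tuples_complete => x Hx.
  exact: IH _ Hx _ (Hall _ Hx) (leq_trans (height_In Hx) Hh).
- rewrite (size0nil Hs).
  by case: n {Hh} => [|n] /=; apply: List.in_or_app; left; apply: List.in_map; exact: In_enum.
Qed.

Lemma bounded_trees_finite n :
  finite_set (fun t : tree (D + Z) => wfT (sumrank rk) t /\ height t <= n).
Proof. by exists (trees_upto n) => t [Ht Hn]; apply: trees_upto_complete. Qed.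

End BoundedTrees.

Section Runs.
Variables (Sigma Delta : finType) (rkS : Sigma -> nat) (rkD : Delta -> nat).
Implicit Type M : dtla rkS rkD.

Lemma nth_map_obind (T U V W : Type) (F : T -> U -> option V) (G : T -> U -> option W)
    (k : W -> option V) ts i q :
  (forall t, List.In t ts -> F t q = obind k (G t q)) ->
  nth (fun _ => None) (map F ts) i q = obind k (nth (fun _ => None) (map G ts) i q).
Proof.
elim: ts i => [|t ts IH] [|i] //= H; first by apply: H; left.
by apply: IH => u Hu; apply: H; right.
Qed.

Lemma nth_map_Some (T U V : Type) (F : T -> U -> option V) ts i q w :
  nth (fun _ => None) (map F ts) i q = Some w -> exists2 t, List.In t ts & F t q = Some w.
Proof.
elim: ts i => [|t ts IH] [|i] //= H; first by exists t; [left|].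
by have [u Hu E] := IH _ H; exists u; [right|].
Qed.

Lemma qrun_wf M (X Z : Type) (look : X -> stP M) (hq : stQ M -> X -> tree (Delta + Z)) q t u :
  (forall q x, wfT (sumrank rkD) (hq q x)) ->
  wfT (sumrank rkS) t -> qrun look hq q t = Some u -> wfT (sumrank rkD) u.
Proof.
move=> Hhq; elim/tree_ind_in: t q u => [[a|x] ts IH] q u /=; last by move=> _ [<-].
move=> /andP[/eqP Hsz /all_In Hall].
case E: (rhs _ _ _) => [r|] // Hsub.
have /andP[Hr _] := rhs_wf (etrans (size_map _ _) Hsz) E.
apply: (tsubst_wf _ Hr Hsub) => qi w /(nth_map_Some (F := fun t q => qrun look hq q t)).
move=> [t Ht Hq].
exact: IH _ Ht _ _ (Hall _ Ht) Hq.
Qed.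

Lemma run_wf M (X Z : Type) (look : X -> stP M) (hq : stQ M -> X -> tree (Delta + Z)) t u :
  (forall q x, wfT (sumrank rkD) (hq q x)) ->
  wfT (sumrank rkS) t -> run look hq t = Some u -> wfT (sumrank rkD) u.
Proof. by move=> Hhq Ht; apply: tsubst_wf (axm_wf _) => q w; apply: qrun_wf. Qed.

Lemma ground_in_wf (s : tree Sigma) : wfT rkS s -> wfT (sumrank rkS) (ground_in s).
Proof.
elim/tree_ind_in: s => a ts IH /= /andP[Hs /all_In Hall].
rewrite size_map Hs; apply/all_In => x /List.in_map_iff [t [<- Ht]].
exact: IH _ Ht (Hall _ Ht).
Qed.

Fixpoint plug (C : tree (Sigma + unit)) (s : tree Sigma) : tree Sigma :=
  let: Node l ts := C in
  if l is inl a then Node a (map (plug^~ s) ts) else s.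

Lemma plug_wf C s : wfT (sumrank rkS) C -> wfT rkS s -> wfT rkS (plug C s).
Proof.
move=> + Hs; elim/tree_ind_in: C => [[a|u] ts IH] //= /andP[Hsz /all_In Hall].
rewrite size_map Hsz; apply/all_In => x /List.in_map_iff [c [<- Hc]].
exact: IH _ Hc (Hall _ Hc).
Qed.

Definition qtransl M (q : stQ M) (s : tree Sigma) :=
  qrun (M := M) (X := void) (Z := void) (of_void _) (fun _ => of_void _) q (ground_in s).

Definition ctx_qout M (p : stP M) (q : stQ M) (C : tree (Sigma + unit)) :=
  qrun (M := M) (X := unit) (Z := stQ M * stP M) (fun _ => p)
    (fun q _ => Node (inr (q, p)) [::]) q C.

Lemma gstate_plug M C s :
  gstate M (plug C s) = lstate (M := M) (X := unit) (fun _ => gstate M s) C.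
Proof.
elim/tree_ind_in: C => [[a|u] ts IH] //=.
by congr (delta _ _); rewrite /gstate /= -!map_comp; apply: map_ext_in.
Qed.

Lemma qtransl_plug M C s q :
  qtransl q (plug C s) =
  obind (tsubst (fun qp : stQ M * stP M => qtransl qp.1 s)) (ctx_qout (gstate M s) q C).
Proof.
elim/tree_ind_in: C q => [[a|u] ts IH] q //=.
rewrite {1}/qtransl /= -!map_comp.
rewrite (map_ext_in (g := lstate (fun _ => gstate M s))); last first.
  by move=> c _; rewrite /= -gstate_plug.
case: (rhs _ _ _) => [r|] //=; rewrite tsubst_obind; apply: tsubst_ext => qi.
by apply: nth_map_obind => c Hc; apply: IH.
Qed.

Lemma transl_plug M C s :
  transl M (plug C s) =
  obind (tsubst (fun qp : stQ M * stP M => qtransl qp.1 s)) (ctx_out C (gstate M s)).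
Proof.
rewrite /transl /run /ctx_out -/(gstate M _) gstate_plug tsubst_obind.
by apply: tsubst_ext => q; apply: qtransl_plug.
Qed.

End Runs.

Section DtopEquivalent.
Variables (Sigma Delta : finType) (rkS : Sigma -> nat) (rkD : Delta -> nat).
Implicit Type K : dtla rkS rkD.

Lemma dtop_state_eq K (x y : stP K) : is_dtop K -> x = y.
Proof.
move=> HK; have /card_le1_eqP le1 : #|stP K| <= 1 by rewrite HK.
exact: le1.
Qed.

Lemma qtransl_wf K q s u : wfT rkS s -> qtransl (M := K) q s = Some u -> wfT (sumrank rkD) u.
Proof. by move=> Hs; apply: qrun_wf (ground_in_wf Hs) => ? []. Qed.

Lemma ctx_out_wf K C p u :
  wfT (sumrank rkS) C -> ctx_out (M := K) C p = Some u -> wfT (sumrank rkD) u.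
Proof. exact: run_wf. Qed.

Definition out_height K (s : tree Sigma) : nat :=
  \max_(q : stQ K) (if qtransl q s is Some t then height t else 0).

Lemma out_height_ub K q s u : qtransl (M := K) q s = Some u -> height u <= out_height K s.
Proof. by move=> E; apply: leq_trans (leq_bigmax q); rewrite E. Qed.

Variables (M N : dtla rkS rkD) (wit : stP M -> tree Sigma).
Hypotheses (wit_wf : forall p, wfT rkS (wit p)) (wit_state : forall p, gstate M (wit p) = p).
Hypotheses (M_total : total_dtla M) (N_dtop : is_dtop N) (MN : equivalent M N).

Let kM := \max_(p : stP M) out_height M (wit p).
Let kN := \max_(p : stP M) out_height N (wit p).

Lemma qtransl_wit_height K q p u :
  qtransl (M := K) q (wit p) = Some u -> height u <= \max_(p : stP M) out_height K (wit p).
Proof. by move/out_height_ub/leq_trans; apply; apply: leq_bigmax. Qed.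

Lemma diff_wf T : diff (M := M) T -> wfT (sumrank rkD) T.
Proof.
move=> [C [p [_ [t1 [_ [v [/andP[Cwf _] E1 _ _ HT]]]]]]].
by have [] := subtree_wf (ctx_out_wf Cwf E1) HT.
Qed.

Lemma plug_wit_outputs C p t :
  wfT (sumrank rkS) C -> ctx_out C p = Some t ->
  exists u y, [/\ tsubst (fun qp => qtransl qp.1 (wit p)) t = Some u,
    ctx_out (M := N) C (gstate N (wit p)) = Some y &
    tsubst (fun rp => qtransl (M := N) rp.1 (wit p)) y = Some u].
Proof.
move=> Cwf Et; have Hwf := plug_wf Cwf (wit_wf p).
case Eu: (transl M (plug C (wit p))) => [u|]; last by case: (M_total Hwf).
have := transl_plug N C (wit p); rewrite -MN // Eu.
case: (ctx_out _ _) => [y|] //= Fu; exists u, y; split=> //.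
by move: Eu; rewrite transl_plug wit_state Et.
Qed.

Lemma diff_height T : diff (M := M) T -> height T <= kM + kN.
Proof.
move=> [C [p [p' [t1 [t2 [v [/andP[Cwf _] E1 E2 Hbot HT]]]]]]].
have [u1 [y [T1 Y1 F1]]] := plug_wit_outputs Cwf E1.
have [u2 [y' [T2 Y2 F2]]] := plug_wit_outputs Cwf E2.
rewrite (dtop_state_eq (gstate N (wit p')) (gstate N (wit p)) N_dtop) Y1 in Y2.
case: Y2 => <-{y'} in F2.
apply: (bot_node_height (ctx_out_wf Cwf E1) (ctx_out_wf Cwf E2) (ctx_out_wf Cwf Y1))
  T1 F1 T2 F2 Hbot HT.
- by move=> qp w /qtransl_wit_height.
- move=> rp w Hw; split; first exact: qtransl_wf (wit_wf p) Hw.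
  exact: qtransl_wit_height Hw.
Qed.

End DtopEquivalent.

Theorem mainTheorem6 (Sigma Delta : finType) (rkS : Sigma -> nat) (rkD : Delta -> nat)
    (M : dtla rkS rkD) :
  la_reachable M -> total_dtla M ->
  (exists N : dtla rkS rkD, is_dtop N /\ equivalent M N) ->
  finite_set (@diff _ _ _ _ M).
Proof.
move=> reachM totM [N [dtopN MN]].
have [wit /all_and2 [wit_wf wit_state]] := fin_all_exists reachM.
have [l Hl] := @bounded_trees_finite _ (stQ M * stP M)%type rkD
  (\max_(p : stP M) out_height M (wit p) + \max_(p : stP M) out_height N (wit p)).
exists l => T HT; apply: Hl; split; first exact: diff_wf HT.
exact: diff_height wit_wf wit_state totM dtopN MN T HT.
Qed.
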